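(* Let $\mathfrak{X}$ be a $\Sigma^*_{\mathfrak{B}}$-countably generated $C^*$-module over a $\Sigma^*$-algebra $\mathfrak{B}\subseteq B(\mathcal{H})$. Then $\mathfrak{X}$ is a $\Sigma^*$-module over $\mathfrak{B}$ if and only if $\mathfrak{X}$ is selfdual.
   Context: WOT is the weak operator topology. A (concrete) $\Sigma^*$-algebra is a nondegenerate $C^*$-algebra $\mathfrak{B} \subseteq B(\mathcal{H})$ such that the limit in $B(\mathcal{H})$ of every WOT-convergent sequence in $\mathfrak{B}$ lies in $\mathfrak{B}$. A $C^*$-module over a $C^*$-algebra $A$ means a right Hilbert $C^*$-module, with $A$-valued inner product $\langle\cdot|\cdot\rangle$ linear and $A$-linear in the second variable and conjugate-linear in the first. $X\otimes_{\mathfrak{B}}\mathcal{H}$ is the Hilbert space completion of the algebraic module tensor product $X\odot_{\mathfrak{B}}\mathcal{H}$ for the inner product determined by $\langle x\otimes\zeta,y\otimes\eta\rangle=\langle\zeta,\langle x|y\rangle\eta\rangle$, and $X$ is canonically embedded in $B(\mathcal{H},X\otimes_{\mathfrak{B}}\mathcal{H})$ by $x(\zeta)=x\otimes\zeta$. A $C^*$-module $\mathfrak{X}$ over $\mathfrak{B}$ is a $\Sigma^*$-module if its canonical image in $B(\mathcal{H},\mathfrak{X}\otimes_{\mathfrak{B}}\mathcal{H})$ is WOT sequentially closed. For a sequence $(x_n)$ and $x$ in a $C^*$-module $X$ over $\mathfrak{B}$, $x_n\to x$ in WOT$_{\mathfrak{B}}$ means $\langle x_n|y\rangle\to\langle x|y\rangle$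 WOT in $B(\mathcal{H})$ for all $y\in X$. $X$ is $\Sigma^*_{\mathfrak{B}}$-countably generated if there is a countable set $\{x_i\}_{i=1}^\infty\subseteq X$ such that the only subset of $X$ that contains $\{\sum_{i=1}^N x_ib_i : b_i\in\mathfrak{B},N\in\mathbb{N}\}$ and is closed under limits (in $X$) of WOT$_{\mathfrak{B}}$-convergent sequences is $X$ itself. $X$ is selfdual if every bounded $\mathfrak{B}$-module map $X\to\mathfrak{B}$ is of the form $\langle x|\cdot\rangle$ for some $x\in X$. *)

(* Defs.v *)
From HB Require Import structures.
From mathcomp Require Import all_boot all_order all_algebra.
From mathcomp Require Import complex.
From mathcomp Require Import all_classical all_reals all_analysis.

Set Implicit Arguments.
Unset Strict Implicit.
Unset Printing Implicit Defensive.

Import Order.TTheory GRing.Theory Num.Theory.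
Import numFieldNormedType.Exports.

Local Open Scope classical_set_scope.
Local Open Scope ring_scope.
Local Open Scope complex_scope.

(* R[i] itself carries no canonical topology; packing it as a
   numClosedFieldType gives it the one of numFieldNormedType. *)
Definition cplx (R : realType) : numClosedFieldType := R[i].
Arguments cplx : simpl never.

HB.mixin Record isHilbert (R : realType) H & CompleteNormedModule (cplx R) H := {
  hilbert_dot : {dot H for @Num.conj (cplx R)} ;
  hilbert_dotE : forall h : H, `|h| ^+ 2 = hilbert_dot h h
}.

#[short(type="hilbertType")]
HB.structure Definition Hilbert (R : realType) :=
  {H of isHilbert R H & CompleteNormedModule (cplx R) H}.

(* {dot _ for _} is linear in its first argument, whereas inner products are
   linear in the second one here, hence the swap. *)
Definition ip (R : realType) (H : hilbertType R) (h k : H) : cplx R :=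
  hilbert_dot k h.

Definition linspan (K : numFieldType) (V : lmodType K) (A : set V) : set V :=
  [set v | exists n (c : 'I_n -> K) (a : 'I_n -> V),
    (forall i, A (a i)) /\ v = \sum_(i < n) c i *: a i].

Section Operators.
Variables (R : realType) (H K : hilbertType R).

(* B(H, K), as a set of functions *)
Definition bounded_op : set (H -> K) :=
  [set T | linear T /\ exists M : cplx R, forall h, `|T h| <= M * `|h|].

(* Norms take their values in cplx R, hence the real part before the sup. *)
Definition opnorm (T : H -> K) : R :=
  sup [set complex.Re `|T h| | h in [set h : H | `|h| <= 1]].

Definition is_adjoint (T : H -> K) (S : K -> H) : Prop :=
  forall h k, ip (T h) k = ip h (S k).

Definition wot_cvg (u : nat -> H -> K) (T : H -> K) : Prop :=
  forall (h : H) (k : K), (fun n => ip k (u n h)) @ \oo --> ip k (T h).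

Definition wot_seq_closed (A : set (H -> K)) : Prop :=
  forall (u : nat -> H -> K) (T : H -> K),
    (forall n, A (u n)) -> bounded_op T -> wot_cvg u T -> A T.

End Operators.

Section Algebras.
Variables (R : realType) (H : hilbertType R).

Record cstar_subalgebra (B : set (H -> H)) : Prop := CstarSubalgebra {
  cstar_bounded : B `<=` @bounded_op R H H ;
  cstar_zero : B 0 ;
  cstar_lin : forall (a : cplx R) S T, B S -> B T -> B (a *: S + T) ;
  cstar_comp : forall S T, B S -> B T -> B (S \o T) ;
  cstar_adj : forall S, B S -> exists2 T, B T & is_adjoint S T ;
  cstar_closed : forall T, bounded_op T ->
    (forall e : R, 0 < e -> exists2 S, B S & opnorm (T - S) < e) -> B T
}.

Definition nondegenerate (B : set (H -> H)) : Prop :=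
  dense (linspan [set x : H | exists b h, B b /\ x = b h]).

Record sigma_star_algebra (B : set (H -> H)) : Prop := SigmaStarAlgebra {
  sigma_star_cstar : cstar_subalgebra B ;
  sigma_star_nondegenerate : nondegenerate B ;
  sigma_star_wot_closed : wot_seq_closed B
}.

End Algebras.

(* A right Hilbert C*-module over the C*-algebra B. The action cm_act x b and
   its laws are only relevant for b in B. Completeness is part of cm_sort. *)
Record cstar_module (R : realType) (H : hilbertType R) (B : set (H -> H)) :=
  CstarModule {
  cm_sort :> completeNormedModType (cplx R) ;
  cm_act : cm_sort -> (H -> H) -> cm_sort ;
  cm_inner : cm_sort -> cm_sort -> H -> H ;
  cm_actDl : forall x y b, B b -> cm_act (x + y) b = cm_act x b + cm_act y b ;
  cm_actDr : forall x b c, B b -> B c ->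
    cm_act x (b + c) = cm_act x b + cm_act x c ;
  cm_actZl : forall (a : cplx R) x b, B b ->
    cm_act (a *: x) b = a *: cm_act x b ;
  cm_actZr : forall (a : cplx R) x b, B b ->
    cm_act x (a *: b) = a *: cm_act x b ;
  cm_actA : forall x b c, B b -> B c ->
    cm_act x (b \o c) = cm_act (cm_act x b) c ;
  cm_inner_in : forall x y, B (cm_inner x y) ;
  cm_inner_linear : forall x, linear (cm_inner x) ;
  cm_inner_act : forall x y b, B b ->
    cm_inner x (cm_act y b) = cm_inner x y \o b ;
  cm_inner_adj : forall x y, is_adjoint (cm_inner x y) (cm_inner y x) ;
  cm_inner_ge0 : forall x h, 0 <= ip h (cm_inner x x h) ;
  cm_inner_eq0 : forall x, cm_inner x x = 0 -> x = 0 ;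
  cm_normE : forall x, `|x| ^+ 2 = (opnorm (cm_inner x x))%:C :> cplx R
}.

(* A realisation of the Hilbert space completion of the algebraic module tensor
   product of X and H over B: the bilinear balanced map it_tens amounts to a
   linear map from the algebraic tensor product, and it_ip and it_dense say that
   this map is isometric with dense range. Such a realisation is unique up to a
   unitary compatible with it_tens. *)
Record interior_tensor (R : realType) (H : hilbertType R) (B : set (H -> H))
    (X : cstar_module B) := InteriorTensor {
  it_sort :> hilbertType R ;
  it_tens : X -> H -> it_sort ;
  it_linearl : forall h, linear (it_tens ^~ h) ;
  it_linearr : forall x, linear (it_tens x) ;
  it_balanced : forall x b h, B b -> it_tens (cm_act x b) h = it_tens x (b h) ;
  it_ip : forall x y h k,
    ip (it_tens x h) (it_tens y k) = ip h (cm_inner x y k) ;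
  it_dense : dense (linspan [set z : it_sort | exists x h, z = it_tens x h])
}.

Section Modules.
Variables (R : realType) (H : hilbertType R) (B : set (H -> H)).
Variable X : cstar_module B.

(* x in X is identified with the operator it_tens x : H -> T. *)
Definition sigma_star_module (T : interior_tensor X) : Prop :=
  wot_seq_closed (range (@it_tens R H B X T)).

Definition wotB_cvg (u : nat -> X) (x : X) : Prop :=
  forall y : X, wot_cvg (fun n => cm_inner (u n) y) (cm_inner x y).

Definition wotB_seq_closed (S : set X) : Prop :=
  forall (u : nat -> X) (x : X), (forall n, S (u n)) -> wotB_cvg u x -> S x.

Definition sigma_star_countably_generated : Prop :=
  exists x : nat -> X, forall S : set X,
    (forall (N : nat) (b : nat -> H -> H), (forall i, B (b i)) ->
       S (\sum_(i < N) cm_act (x i) (b i))) ->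
    wotB_seq_closed S -> S = setT.

Definition bounded_module_map (f : X -> H -> H) : Prop :=
  [/\ forall x, B (f x), linear f,
      forall x b, B b -> f (cm_act x b) = f x \o b &
      exists M : R, forall x, opnorm (f x) <= M * complex.Re `|x|].

Definition selfdual : Prop :=
  forall f : X -> H -> H, bounded_module_map f ->
    exists x : X, forall y : X, f y = cm_inner x y.

End Modules.

(* Main.v *)
Require Import Defs.
From HB Require Import structures.
From mathcomp Require Import all_boot all_order all_algebra.
From mathcomp Require Import complex.
From mathcomp Require Import all_classical all_reals all_analysis.
From mathcomp Require Import ring lra.

Set Implicit Arguments.
Unset Strict Implicit.
Unset Printing Implicit Defensive.

Import Order.TTheory GRing.Theory Num.Theory.
Import numFieldNormedType.Exports.

Local Open Scope classical_set_scope.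
Local Open Scope ring_scope.

(** Closed modules and selfdual modules.

    One direction is soft. If the module [X] is selfdual and the operator [S] is
    the WOT limit of elements of [X], then [y |-> S^* y] is the limit of the maps
    [cm_inner (u n)], so it takes its values in [B]; it is a bounded module map,
    and the element representing it is [S]: see [selfdual_sigma_star_module].

    For the other direction let [f : X -> B] be a bounded module map. A map of the
    form [f \o e] with [e] a finite rank operator [\sum_i |v i><w i|] is always
    represented by an element, and what is needed are bounded finite rank
    operators tending strongly to the identity. They are built from
    [A = \sum_(i < N) |x i><x i|] for generators [x i] scaled so that [A] is a
    contraction: [e = 1 - (1 - A)^N] is a polynomial in [A] without constant term,
    so it has finite rank, and no square root or inverse of an operator is
    involved. The rate at which [(1 - A)^n] kills the range of [A]
    ([landweber_rate]) is explicit enough for [N] to serve both as the number of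
    generators and as the number of iterations.

    Three facts then give the result. First, Paschke's inequality, up to a
    constant, [module_map_tens_le]: the norm of [f y h] is at most a multiple of
    that of [y ⊗ h]. It is a consequence of the same construction for the family
    reduced to [y]. Second, [residual_cvg0]: [(1 - A)^N] tends strongly to [0] on
    the tensor product. Its limit on [y ⊗ h] exists as an orthogonal projection;
    [X] being closed, the limit is of the form [u ⊗ h] with [u] in [X]; this [u]
    is orthogonal to the generators, which kills it because orthogonality to a
    given element of [X] passes to limits in WOT over [B]. Third,
    [sigma_star_module_complete]: the bounded sequence of the elements
    representing [f \o e] converges in [X], [X] being closed. Its limit
    represents [f]. *)

(** * Complex scalars and real-valued norms *)

Section Scalars.
Variable R : realType.
Implicit Types a b : cplx R.

(** [re] and [rc] are the real part and the embedding of the reals, retyped at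
    [cplx R] so that rewriting never exposes the underlying pairs of reals. *)
Definition re (a : cplx R) : R := complex.Re (a : R[i]).
Definition rc (r : R) : cplx R := (r%:C)%C.

Lemma reD a b : re (a + b) = re a + re b.
Proof. by case: a b => [? ?] [? ?]. Qed.

Lemma reN a : re (- a) = - re a.
Proof. by case: a. Qed.

Lemma reB a b : re (a - b) = re a - re b.
Proof. by rewrite reD reN. Qed.

Lemma re0 : re 0 = 0. Proof. by []. Qed.

Lemma re_sum (I : Type) (r : seq I) (F : I -> cplx R) :
  re (\sum_(i <- r) F i) = \sum_(i <- r) re (F i).
Proof. exact: (big_morph re reD re0). Qed.

Lemma re_conj a : re a^* = re a.
Proof. by case: a. Qed.

Lemma rcK r : re (rc r) = r. Proof. by []. Qed.

Lemma reZ r a : re (rc r * a) = r * re a.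
Proof. by case: a => x y; rewrite /re /rc /= mul0r subr0. Qed.

Lemma rc_conj r : (rc r)^* = rc r.
Proof. exact: (@conjc_real R). Qed.

Lemma rcM r s : rc (r * s) = rc r * rc s.
Proof. exact: (@rmorphM _ _ (real_complex R)). Qed.

Lemma rcD r s : rc (r + s) = rc r + rc s.
Proof. exact: (@rmorphD _ _ (real_complex R)). Qed.

Lemma rc_eq0 r : (rc r == 0) = (r == 0).
Proof. exact: (@fmorph_eq0 _ _ (real_complex R)). Qed.

Lemma rc_inj : injective rc.
Proof. by move=> r s [->]. Qed.

Lemma rc_le r s : (rc r <= rc s) = (r <= s).
Proof. exact: (@lecR R). Qed.

Lemma rc_lt r s : (rc r < rc s) = (r < s).
Proof. exact: (@ltcR R). Qed.

Lemma rc_ge0 a : 0 <= a -> a = rc (re a).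
Proof.
move=> a0; have := @RRe_real R a (ger0_real a0); rewrite /rc /re => -> //.
Qed.

Lemma re_ge0 a : 0 <= a -> 0 <= re a.
Proof. by move=> a0; rewrite -rc_le -rc_ge0. Qed.

End Scalars.

Section RealNorm.
Variable R : realType.

(** The norm of a complex normed module takes its values in [cplx R]; [rn] is the
    same norm with real values, where order and limits are those of a complete
    ordered field. *)
Definition rn (V : normedModType (cplx R)) (v : V) : R := re `|v|.

Section Theory.
Variable V : normedModType (cplx R).
Implicit Types v w : V.

Lemma rnE v : `|v| = rc (rn v).
Proof. by rewrite /rn -rc_ge0. Qed.

Lemma rn_ge0 v : 0 <= rn v.
Proof. exact: re_ge0. Qed.

Lemma rn0 : rn (0 : V) = 0.
Proof. by rewrite /rn normr0. Qed.

Lemma rnN v : rn (- v) = rn v.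
Proof. by rewrite /rn normrN. Qed.

Lemma rn_dist v w : rn (v - w) = rn (w - v).
Proof. by rewrite -rnN opprB. Qed.

Lemma rnD v w : rn (v + w) <= rn v + rn w.
Proof. by rewrite -rc_le rcD -!rnE ler_normD. Qed.

Lemma rnB v w : rn (v - w) <= rn v + rn w.
Proof. by rewrite -(rnN w) rnD. Qed.

Lemma rnZ a v : rn (a *: v) = rn (a : cplx R) * rn v.
Proof. by apply: rc_inj; rewrite rcM -!rnE normrZ. Qed.

Lemma rn_eq0 v : rn v = 0 -> v = 0.
Proof. by move=> v0; apply/eqP; rewrite -normr_eq0 rnE v0. Qed.

End Theory.

Lemma rcN (r : R) : rc (- r) = - rc r.
Proof. by apply/eqP; rewrite eq_complex /= oppr0 !eqxx. Qed.

Lemma rn_rc (r : R) : rn (rc r) = `|r|.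
Proof.
have pos (s : R) : 0 <= s -> rn (rc s) = s.
  by move=> s0; apply: rc_inj; rewrite -rnE ger0_norm // -[0]/(rc 0) rc_le.
case: (lerP 0 r) => r0; first by rewrite pos ?ger0_norm.
by rewrite -rnN -rcN pos ?ltr0_norm // oppr_ge0 ltW.
Qed.

Lemma rnM (a b : cplx R) : rn (a * b) = rn a * rn b.
Proof. by apply: rc_inj; rewrite rcM -!rnE normrM. Qed.

Lemma rn_conj (a : cplx R) : rn a^* = rn a.
Proof. by apply: rc_inj; rewrite -!rnE norm_conjC. Qed.

Lemma mul_conj (a : cplx R) : a * a^* = rc (rn a ^+ 2).
Proof. by rewrite -normCK rnE !expr2 -rcM. Qed.

Lemma ler_re_rn (a : cplx R) : `|re a| <= rn a.
Proof. by rewrite -rc_le -rnE; exact: (@normc_ge_Re R). Qed.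

Lemma re_le_rn (a : cplx R) : re a <= rn a.
Proof. exact: le_trans (ler_norm _) (ler_re_rn a). Qed.

Lemma lin0 (U V : lmodType (cplx R)) (f : U -> V) : linear f -> f 0 = 0.
Proof. by move=> lin; have := lin (-1) 0 0; rewrite scaler0 addr0 scaleN1r addNr. Qed.

Lemma linZ (U V : lmodType (cplx R)) (f : U -> V) a v :
  linear f -> f (a *: v) = a *: f v.
Proof. by move=> lin; rewrite -[a *: v]addr0 lin lin0 // addr0. Qed.

End RealNorm.

(** * Convergence in terms of real-valued norms *)

Section Convergence.
Variables (R : realType) (V : normedModType (cplx R)).

Lemma cvg_rn (u : nat -> V) (l : V) :
  u @ \oo --> l <-> (fun n => rn (u n - l)) @ \oo --> (0 : R).
Proof.
split.
  move=> /cvgrPdist_lt ul; apply/cvgrPdist_lt => e e0.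
  have e0' : 0 < rc e :> cplx R by rewrite -[0]/(rc 0) rc_lt.
  have := ul _ e0'; apply: filterS => n.
  by rewrite sub0r normrN ger0_norm ?rn_ge0 // rnE rc_lt rn_dist.
move=> /cvgrPdist_lt ul; apply/cvgrPdist_lt => e e0.
have e0' : 0 < re e by rewrite -rc_lt -rc_ge0 // ltW.
have := ul _ e0'; apply: filterS => n.
rewrite sub0r normrN ger0_norm ?rn_ge0 // => ule.
by rewrite rnE (rc_ge0 (ltW e0)) rc_lt rn_dist.
Qed.

Lemma cvg_rnP (u : nat -> V) (l : V) :
  u @ \oo --> l <->
  forall e : R, 0 < e -> exists N, forall n, (N <= n)%N -> rn (u n - l) < e.
Proof.
rewrite cvg_rn; split=> [/cvgrPdist_lt ul e /ul [N _ Nu]|ul].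
  exists N => n /Nu /=.
  by rewrite sub0r normrN ger0_norm ?rn_ge0.
apply/cvgrPdist_lt => e /ul [N Nu]; exists N => // n /Nu /=.
by rewrite sub0r normrN ger0_norm ?rn_ge0.
Qed.

Lemma cvg_rn_le (u : nat -> V) (l : V) (b : nat -> R) :
  (forall n, rn (u n - l) <= b n) -> b @ \oo --> (0 : R) -> u @ \oo --> l.
Proof.
move=> ub b0; apply/cvg_rn/(@squeeze_cvgr _ _ _ _ (fun=> 0) b) => //.
  by apply: nearW => n; rewrite rn_ge0 ub.
exact: cvg_cst.
Qed.

Lemma cvg_uniq (u : nat -> V) (l l' : V) :
  u @ \oo --> l -> u @ \oo --> l' -> l = l'.
Proof. by move=> ul ul'; apply: (@cvg_unique _ (@norm_hausdorff _ V) (u @ \oo)). Qed.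

Lemma cvg_to_rn (u : nat -> V) (l : V) :
  u @ \oo --> l -> (fun n => rn (u n)) @ \oo --> rn l.
Proof.
move=> /cvg_rnP ul; apply/cvgrPdist_lt => e /ul [N Nu]; exists N => // n /Nu.
apply: le_lt_trans; rewrite ler_norml.
have := rnD (u n - l) l; have := rnD (l - u n) (u n).
by rewrite !subrK (rn_dist l) => ? ?; apply/andP; split; lra.
Qed.

Lemma cvg_rn_bound (u : nat -> V) (l : V) (C : R) :
  (forall n, rn (u n) <= C) -> u @ \oo --> l -> rn l <= C.
Proof.
move=> uC /cvg_to_rn ul; apply: ler_cvg_to ul (cvg_cst C) _.
exact: nearW.
Qed.

Lemma cvg_lin (a : cplx R) (u v : nat -> V) (l m : V) :
  u @ \oo --> l -> v @ \oo --> m ->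
  (fun n => a *: u n + v n) @ \oo --> a *: l + m.
Proof.
move=> /cvg_rn ul /cvg_rn vm.
apply: (@cvg_rn_le _ _ (fun n => rn a * rn (u n - l) + rn (v n - m))) => [n|].
  rewrite -rnZ scalerBr; apply: le_trans (rnD _ _).
  by rewrite opprD addrACA.
rewrite -[0 : R]addr0 -{1}(mulr0 (rn a)); apply: cvgD => //.
exact: cvgMl_tmp.
Qed.

End Convergence.

Lemma cvg_scalar_lin (R : realType) (a : cplx R) (u v : nat -> cplx R) (l m : cplx R) :
  u @ \oo --> l -> v @ \oo --> m ->
  (fun n => a * u n + v n) @ \oo --> a * l + m.
Proof. exact: (@cvg_lin R (cplx R)). Qed.

Lemma rn_cauchy_cvg (R : realType) (V : completeNormedModType (cplx R)) (u : nat -> V) :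
  (forall e : R, 0 < e ->
     exists N, forall m n, (N <= m)%N -> (N <= n)%N -> rn (u m - u n) < e) ->
  exists l : V, u @ \oo --> l.
Proof.
move=> uc; apply/cvg_ex; apply: cauchy_cvg; apply/cauchy_exP => e e0.
have e0' : 0 < re e by rewrite -rc_lt -rc_ge0 // ltW.
have [N Nu] := uc _ e0'; exists (u N); exists N => // n Nn.
by rewrite /= -ball_normE /ball_ /= rnE (rc_ge0 (ltW e0)) rc_lt Nu.
Qed.

(** Real and imaginary parts converge separately, each being dominated by the
    modulus. *)
Lemma cplx_cauchy_cvg (R : realType) (u : nat -> cplx R) :
  (forall e : R, 0 < e ->
     exists N, forall m n, (N <= m)%N -> (N <= n)%N -> rn (u m - u n) < e) ->
  exists l : cplx R, u @ \oo --> l.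
Proof.
move=> uc.
have part (p : cplx R -> R) : (forall a b, p (a - b) = p a - p b) ->
    (forall a, `|p a| <= rn a) -> exists l : R, p \o u @ \oo --> l.
  move=> pB p_le; apply/cvg_ex; apply: cauchy_cvg; apply/cauchy_exP => e /uc [N Nu].
  exists (p (u N)); exists N => // n Nn.
  rewrite /= -ball_normE /ball_ /= -pB.
  by apply: le_lt_trans (p_le _) _; exact: Nu.
have rn_i : rn ('i%C : cplx R) = 1.
  apply: rc_inj; rewrite -rnE; apply/eqP.
  by rewrite -sqrp_eq1 // sqr_normc; simpc.
have [x ux] := part (@re R) (@reB R) (@ler_re_rn R).
have [y uy] : exists l : R, (fun n => complex.Im (u n : R[i])) @ \oo --> l.
  apply: (part (fun a => complex.Im (a : R[i]))) => [[? ?] [? ?]//|a].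
  rewrite -normrN -(ReiNIm (a : R[i])).
  by apply: le_trans (ler_re_rn (a * 'i%C : cplx R)) _; rewrite rnM rn_i mulr1.
exists ((x +i* y)%C : cplx R).
apply: (@cvg_rn_le _ _ _ _ (fun n => `|re (u n) - x| + `|complex.Im (u n : R[i]) - y|)).
  move=> n; move: (u n) => [a b].
  have -> : ((a +i* b)%C - (x +i* y)%C : cplx R) = rc (a - x) + 'i%C * rc (b - y).
    by apply/eqP; rewrite eq_complex /=; apply/andP; split; apply/eqP => /=; ring.
  apply: le_trans (rnD _ _) _; rewrite rnM rn_i mul1r.
  by rewrite !rn_rc.
have dist0 (f : nat -> R) (l : R) :
    f @ \oo --> l -> (fun n => `|f n - l|) @ \oo --> (0 : R).
  by move=> /subr_cvg0 /cvg_norm; rewrite normr0.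
by rewrite -[0 : R]addr0; apply: cvgD; exact: dist0.
Qed.
(** * Inner products *)

Section InnerProduct.
Variables (R : realType) (H : hilbertType R).
Implicit Types (v w : H) (a : cplx R).

Lemma ipDr v w w' : ip v (w + w') = ip v w + ip v w'.
Proof. by rewrite /ip linearDl. Qed.

Lemma ipZr v a w : ip v (a *: w) = a * ip v w.
Proof. by rewrite /ip linearZl_LR. Qed.

Lemma ip_conj v w : (ip v w)^* = ip w v.
Proof. by rewrite /ip [RHS]hermC /= expr0 mul1r. Qed.

Lemma ipNr v w : ip v (- w) = - ip v w.
Proof. by rewrite -scaleN1r ipZr mulN1r. Qed.

Lemma ipBr v w w' : ip v (w - w') = ip v w - ip v w'.
Proof. by rewrite ipDr ipNr. Qed.

Lemma ip0r v : ip v 0 = 0.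
Proof. by rewrite -(subrr v) ipBr subrr. Qed.

Lemma ipDl v v' w : ip (v + v') w = ip v w + ip v' w.
Proof. by rewrite -ip_conj ipDr rmorphD /= !ip_conj. Qed.

Lemma ipZl a v w : ip (a *: v) w = a^* * ip v w.
Proof. by rewrite -ip_conj ipZr rmorphM /= ip_conj. Qed.

Lemma ipNl v w : ip (- v) w = - ip v w.
Proof. by rewrite -ip_conj ipNr rmorphN /= ip_conj. Qed.

Lemma ipBl v v' w : ip (v - v') w = ip v w - ip v' w.
Proof. by rewrite ipDl ipNl. Qed.

Lemma ip0l v : ip 0 v = 0.
Proof. by rewrite -ip_conj ip0r rmorph0. Qed.

Lemma ip_sumr v n (F : 'I_n -> H) : ip v (\sum_i F i) = \sum_i ip v (F i).
Proof. exact: (big_morph (ip v) (ipDr v) (ip0r v)). Qed.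

Lemma ip_suml n (F : 'I_n -> H) w : ip (\sum_i F i) w = \sum_i ip (F i) w.
Proof.
by apply: (big_morph (fun v => ip v w)) => [v v'|]; [exact: ipDl|exact: ip0l].
Qed.

Lemma ip_rn v : ip v v = rc (rn v ^+ 2).
Proof. by rewrite /ip -hilbert_dotE rnE !expr2 rcM. Qed.

Lemma rn_sqr v : rn v ^+ 2 = re (ip v v).
Proof. by rewrite ip_rn. Qed.

Lemma re_ipC v w : re (ip v w) = re (ip w v).
Proof. by rewrite -ip_conj re_conj. Qed.

Lemma rnB_sqr v w : rn (v - w) ^+ 2 = rn v ^+ 2 + rn w ^+ 2 - 2 * re (ip v w).
Proof.
rewrite !rn_sqr ipBl !ipBr !reB (re_ipC w v); ring.
Qed.

Lemma rnD_sqr v w : rn (v + w) ^+ 2 = rn v ^+ 2 + rn w ^+ 2 + 2 * re (ip v w).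
Proof.
by rewrite -{1}[w]opprK rnB_sqr rnN ipNr reN mulrN opprK.
Qed.

(** Moving [v] along [w] in the phase of [ip w v] makes the squared distance a
    real quadratic polynomial in the step [s]: its minimum yields the
    Cauchy-Schwarz inequality, its slope at [0] the orthogonality of a nearest
    point. *)
Lemma rn_sqr_perturb v w (s : R) :
  rn (v - (rc s * ip w v) *: w) ^+ 2 =
  rn v ^+ 2 - 2 * s * rn (ip w v) ^+ 2 + s ^+ 2 * rn (ip w v) ^+ 2 * rn w ^+ 2.
Proof.
rewrite rnB_sqr ipZr -mulrA reZ -(ip_conj w v) mul_conj rcK.
rewrite rnZ rnM !exprMn rn_rc real_normK ?num_real //.
ring.
Qed.

Lemma cauchy_schwarz v w : rn (ip v w) <= rn v * rn w.
Proof.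
rewrite -ip_conj rn_conj.
have [w0|w0] := eqVneq (rn v) 0.
  by rewrite (rn_eq0 w0) ip0r !rn0 mul0r.
have w_gt0 : 0 < rn v ^+ 2 by rewrite exprn_gt0 // lt_neqAle eq_sym w0 rn_ge0.
rewrite -(@ler_pXn2r _ 2) ?nnegrE ?mulr_ge0 ?rn_ge0 // exprMn.
have := sqr_ge0 (rn (w - (rc (rn v ^- 2) * ip v w) *: v)); rewrite rn_sqr_perturb.
rewrite -ip_conj rn_conj.
set p := rn (ip w v) ^+ 2; set q := rn v ^+ 2; set r := rn w ^+ 2.
have -> : r - 2 * q^-1 * p + q^-1 ^+ 2 * p * q = (q * r - p) / q.
  by field; rewrite gt_eqF.
by rewrite pmulr_lge0 ?invr_gt0 // subr_ge0.
Qed.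

Lemma re_ip_le v w : re (ip v w) <= rn v * rn w.
Proof. exact: le_trans (re_le_rn _) (cauchy_schwarz _ _). Qed.

(** Adjoints move one of the two copies of [v] away from [ip v v]; this turns the
    resulting Cauchy-Schwarz estimate into a bound of the norm. *)
Lemma rn_le_ip v (C : R) : 0 <= C -> re (ip v v) <= rn v * C -> rn v <= C.
Proof.
move=> C0; have [->//|v0] := eqVneq (rn v) 0.
have v_gt0 : 0 < rn v by rewrite lt_def v0 rn_ge0.
by rewrite -rn_sqr expr2 ler_pM2l.
Qed.

Lemma ip_ext v w : (forall z, ip z v = ip z w) -> v = w.
Proof.
move=> vw; apply/eqP; rewrite -subr_eq0; apply/eqP/rn_eq0/eqP.
by rewrite -sqrf_eq0 rn_sqr ipBr vw subrr.
Qed.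

Lemma cvg_ipr (u : nat -> H) l w :
  u @ \oo --> l -> (fun n => ip w (u n)) @ \oo --> ip w l.
Proof.
move=> /cvg_rn ul.
apply: (@cvg_rn_le _ _ _ _ (fun n => rn w * rn (u n - l))) => [n|].
  by rewrite -ipBr cauchy_schwarz.
by rewrite -(mulr0 (rn w)); apply: cvgMl_tmp.
Qed.

Lemma cvg_ip_conj (u : nat -> H) w l :
  (fun n => ip w (u n)) @ \oo --> l -> (fun n => ip (u n) w) @ \oo --> l^*.
Proof.
move=> /cvg_rn ul; apply: (@cvg_rn_le _ _ _ _ (fun n => rn (ip w (u n) - l))) => // n.
by rewrite -ip_conj -rmorphB rn_conj.
Qed.

End InnerProduct.

(** * Orthogonal decomposition and Riesz representation *)

Section Orthogonality.
Variables (R : realType) (H : hilbertType R).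
Implicit Types V : set H.

Definition linear_subspace V :=
    V 0 /\ forall (a : cplx R) v w, V v -> V w -> V (a *: v + w).

Definition seq_closed V :=
  forall (u : nat -> H) (l : H), (forall n, V (u n)) -> u @ \oo --> l -> V l.

(** The component in [V] is the limit of a minimising sequence for the distance
    from [z] to [V], Cauchy by the parallelogram law; minimality forces the
    difference to be orthogonal to [V]. *)
Lemma orthogonal_decomposition V (z : H) : linear_subspace V -> seq_closed V ->
  exists v w, [/\ z = v + w, V v & forall u, V u -> ip u w = 0].
Proof.
move=> [V0 Vlin] Vcl.
pose D := [set rn (z - v) ^+ 2 | v in V].
have D_inf : has_inf D.
  split; first by exists (rn (z - 0) ^+ 2), 0.
  by exists 0 => _ [v _ <-]; apply: sqr_ge0.
have D_lb v : V v -> inf D <= rn (z - v) ^+ 2.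
  by move=> Vv; apply: ge_inf; [case: D_inf|exists v].
have /choice[u Vu] : forall n : nat, exists v,
    V v /\ rn (z - v) ^+ 2 < inf D + n.+1%:R^-1.
  move=> n; have [//|_ [v Vv <-] vlt] := @inf_adherent _ D n.+1%:R^-1 _ D_inf.
  by exists v.
have VD v w : V v -> V w -> V (v + w).
  by move=> Vv Vw; rewrite -[v]scale1r; apply: Vlin.
have VZ a v : V v -> V (a *: v).
  by move=> Vv; rewrite -[a *: v]addr0; apply: Vlin.
have par m n : rn (u m - u n) ^+ 2 <= 2 * (m.+1%:R^-1 + n.+1%:R^-1).
  have -> : u m - u n = (z - u n) - (z - u m) by rewrite [RHS]addrC opprB addrA subrK.
  have := rnB_sqr (z - u n) (z - u m).
  have := rnD_sqr (z - u n) (z - u m).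
  have -> : (z - u n) + (z - u m) = (rc 2) *: (z - (rc 2^-1) *: (u n + u m)).
    rewrite scalerBr scalerA -rcM divff ?pnatr_eq0 // scale1r opprD.
    by rewrite -[rc 2]/(rc (1 + 1)) rcD scalerDl scale1r addrACA.
  rewrite rnZ exprMn rn_rc ger0_norm // => sum_sqr ->.
  have := D_lb _ (VZ (rc 2^-1) _ (VD _ _ (Vu n).1 (Vu m).1)).
  have := (Vu m).2; have := (Vu n).2.
  move: sum_sqr.
  set a := re _; set b := rn (z - u n) ^+ 2; set c := rn (z - u m) ^+ 2.
  set d := rn (_ - _) ^+ 2; set x := m.+1%:R^-1; set y := n.+1%:R^-1.
  by move=> ? ? ? ?; lra.
have [v uv] : exists v : H, u @ \oo --> v.
  apply: rn_cauchy_cvg => e e0.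
  pose N := Num.truncn (4 / e ^+ 2).
  have Ne : N.+1%:R^-1 < e ^+ 2 / 4.
    rewrite invf_plt ?posrE ?divr_gt0 ?exprn_gt0 // invf_div.
    exact: truncnS_gt.
  exists N => m n Nm Nn.
  rewrite -(@ltr_pXn2r _ 2) ?nnegrE ?rn_ge0 ?ltW //.
  apply: le_lt_trans (par m n) _.
  have le_inv k : (N <= k)%N -> k.+1%:R^-1 <= N.+1%:R^-1 :> R.
    by move=> Nk; rewrite lef_pV2 ?posrE // ler_nat.
  move: (le_inv m Nm) (le_inv n Nn) Ne.
  set a := m.+1%:R^-1; set b := n.+1%:R^-1; set c := N.+1%:R^-1.
  by move=> ? ? ?; lra.
have Vv : V v by apply: Vcl uv => n; exact: (Vu n).1.
exists v, (z - v); split => [||w Vw] //; first by rewrite addrC subrK.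
have zv_le : rn (z - v) ^+ 2 <= inf D.
  have cvg_sqr : (fun n => rn (z - u n) * rn (z - u n)) @ \oo --> rn (z - v) * rn (z - v).
    by apply: cvgM; apply: cvg_to_rn; apply: cvgB => //; exact: cvg_cst.
  have cvg_inf : (fun n => inf D + n.+1%:R^-1) @ \oo --> inf D + 0.
    by apply: cvgD; [exact: cvg_cst|exact: cvg_harmonic].
  rewrite -[inf D]addr0 expr2; apply: ler_cvg_to cvg_sqr cvg_inf _.
  by apply: nearW => n; rewrite -expr2; apply/ltW/(Vu n).2.
have p_ge0 := sqr_ge0 (rn (ip w (z - v))).
pose s := (1 + rn w ^+ 2)^-1.
have q1_gt0 : 0 < 1 + rn w ^+ 2 by rewrite ltr_wpDr ?sqr_ge0.
have s_gt0 : 0 < s by rewrite invr_gt0.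
have s_le : s * rn w ^+ 2 <= 1.
  by rewrite /s mulrC ler_pdivrMr // mul1r lerDr.
have := D_lb _ (VD _ _ Vv (VZ (rc s * ip w (z - v)) _ Vw)).
rewrite opprD addrA rn_sqr_perturb.
set p := rn (ip w (z - v)) ^+ 2 in p_ge0 *; set q := rn w ^+ 2 in s_le *.
move=> le1; apply/rn_eq0/eqP; rewrite -sqrf_eq0 -/p eq_le p_ge0 andbT.
rewrite -(pmulr_rle0 _ s_gt0).
have : s * p * (s * q) <= s * p.
  by rewrite ler_piMr // mulr_ge0 // ltW.
by move: le1 zv_le; rewrite -[s ^+ 2]/(s * s) -[2 * s * p]mulrA; lra.
Qed.

(** A representing vector is found on the orthogonal complement of the kernel of
    the functional, which is one-dimensional unless the functional vanishes. *)
Lemma riesz (phi : H -> cplx R) (C : R) :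
  (forall a v w, phi (a *: v + w) = a * phi v + phi w) ->
  (forall v, rn (phi v) <= C * rn v) ->
  exists w, forall v, phi v = ip w v.
Proof.
move=> lin bnd.
have phi0 : phi 0 = 0.
  by apply: rn_eq0; apply/eqP; rewrite eq_le rn_ge0 (le_trans (bnd 0)) // rn0 mulr0.
have phiZ a v : phi (a *: v) = a * phi v by rewrite -[a *: v]addr0 lin phi0 addr0.
have phiB v w : phi (v - w) = phi v - phi w.
  by rewrite addrC -scaleN1r lin mulN1r addrC.
have [phi_eq0|/existsNP[z phiz]] := pselect (forall v, phi v = 0).
  by exists 0 => v; rewrite phi_eq0 ip0l.
have [||v [w [zvw phiv perp]]] :=
    @orthogonal_decomposition [set v | phi v = 0] z.
- by split=> //= a v w v0 w0; rewrite lin v0 w0 mulr0 addr0.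
- move=> u l u0 /cvg_rn ul; apply: (@cvg_uniq _ (cplx R) (phi \o u)); last first.
    have -> : phi \o u = fun=> 0 by apply/funext.
    exact: cvg_cst.
  apply: (@cvg_rn_le _ _ _ _ (fun n => C * rn (u n - l))) => [n|].
    by rewrite /= -phiB bnd.
  by rewrite -(mulr0 C); apply: cvgMl_tmp.
have phiw : phi w != 0.
  apply/eqP => w0; apply: phiz.
  by rewrite zvw -[v]scale1r lin phiv w0 mulr0 addr0.
exists ((phi w / ip w w)^* *: w) => u.
rewrite ipZl conjCK.
have ww : ip w w != 0.
  apply: contra_neq phiw => /eqP; rewrite ip_rn rc_eq0 sqrf_eq0 => /eqP/rn_eq0 ->.
  exact: phi0.
have /perp : [set v | phi v = 0] (u - (phi u / phi w) *: w).
  by rewrite /= phiB phiZ divfK // subrr.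
move=> /(congr1 Num.conj); rewrite ip_conj ipBr ipZr rmorph0 => /eqP.
by rewrite subr_eq0 => /eqP ->; field; rewrite ww phiw.
Qed.

End Orthogonality.

(** * Bounded operators and their adjoints *)

Section BoundedOp.
Variables (R : realType) (H K : hilbertType R).

Lemma bounded_opP (S : H -> K) :
  bounded_op S <-> linear S /\ exists2 C : R, 0 <= C & forall h, rn (S h) <= C * rn h.
Proof.
split=> -[lin [M]].
  move=> bnd; split=> //; exists `|re M| => // h.
  rewrite -rc_le rcM -!rnE; apply: le_trans (bnd h) _.
  have [->|h0] := eqVneq `|h| 0; first by rewrite !mulr0.
  have h_gt0 : 0 < `|h| by rewrite lt_def h0 normr_ge0.
  rewrite ler_pM2r //.
  have /rc_ge0 -> : 0 <= M by rewrite -(pmulr_lge0 _ h_gt0) (le_trans _ (bnd h)).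
  by rewrite rcK rc_le ler_norm.
by move=> M0 bnd; split=> //; exists (rc M) => h; rewrite !rnE -rcM rc_le.
Qed.

End BoundedOp.

Section Adjoint.
Variables (R : realType) (H K : hilbertType R).

Lemma exists_adjoint (S : H -> K) : bounded_op S ->
  exists2 S' : K -> H, bounded_op S' & is_adjoint S S'.
Proof.
move=> /bounded_opP[lin [C C0 bnd]].
have /choice[S' S'E] : forall k, exists w, forall h, ip k (S h) = ip w h.
  move=> k; apply: (@riesz _ _ _ (C * rn k)) => [a v w|v].
    by rewrite lin ipDr ipZr.
  by rewrite mulrAC mulrC (le_trans (cauchy_schwarz _ _)) // ler_wpM2l ?rn_ge0.
have adj h k : ip (S h) k = ip h (S' k) by rewrite -ip_conj S'E ip_conj.
exists S' => //; apply/bounded_opP; split=> [a k k'|].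
  by apply: ip_ext => h; rewrite -adj !ipDr !ipZr -!adj.
exists C => // k; apply: rn_le_ip; first by rewrite mulr_ge0 ?rn_ge0.
rewrite -adj; apply: le_trans (re_ip_le _ _) _.
by rewrite mulrA [_ * C]mulrC ler_wpM2r ?rn_ge0.
Qed.

Lemma ler_opnorm (S : H -> K) h : bounded_op S -> rn (S h) <= opnorm S * rn h.
Proof.
move=> /bounded_opP[lin [C C0 bnd]].
have [h0|h0] := eqVneq (rn h) 0; first by rewrite (rn_eq0 h0) lin0 // !rn0 mulr0.
have h_gt0 : 0 < rn h by rewrite lt_def h0 rn_ge0.
rewrite -ler_pdivrMr // mulrC.
have -> : (rn h)^-1 * rn (S h) = rn (S (rc (rn h)^-1 *: h)).
  by rewrite linZ // rnZ rn_rc ger0_norm // invr_ge0 ltW.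
apply: sup_ubound.
  exists C => _ [k /= k1 <-]; apply: le_trans (bnd k) _.
  by rewrite ler_piMr // -rc_le -rnE.
exists (rc (rn h)^-1 *: h) => //=.
by rewrite rnE rnZ rn_rc gtr0_norm ?invr_gt0 // mulVf.
Qed.

Lemma opnorm_le (S : H -> K) C : 0 <= C -> (forall h, rn (S h) <= C * rn h) ->
  opnorm S <= C.
Proof.
move=> C0 bnd; apply: ge_sup; first by exists (rn (S 0)), 0; rewrite //= normr0.
move=> _ [k /= k1 <-]; apply: le_trans (bnd k) _.
by rewrite ler_piMr // -rc_le -rnE.
Qed.

End Adjoint.
(** * Density and weak limits *)

Section Density.
Variables (R : realType) (H : hilbertType R).
Implicit Types D : set H.

Lemma dense_rn D (z : H) (e : R) : dense D -> 0 < e ->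
  exists2 d, D d & rn (z - d) < e.
Proof.
move=> dD e0; have e0' : 0 < rc e :> cplx R by rewrite -[0]/(rc 0) rc_lt.
have [||d [zd Dd]] := dD (ball z (rc e)).
- by exists z; exact: ballxx.
- exact: ball_open.
- exists d => //; move: zd.
  by rewrite -ball_normE /ball_ /= rnE rc_lt.
Qed.

Lemma total_orthogonal_eq0 D (w : H) : dense (linspan D) ->
  (forall d, D d -> ip d w = 0) -> w = 0.
Proof.
move=> dD Dw; apply/rn_eq0/eqP; apply: contraT => w0.
have w_gt0 : 0 < rn w by rewrite lt_def w0 rn_ge0.
have [_ [n [c [a [Da ->]]]] lt_w] := dense_rn w dD w_gt0.
suff : rn w ^+ 2 < rn w ^+ 2 by rewrite ltxx.
rewrite {1}rn_sqr.
have <- : ip (w - \sum_(i < n) c i *: a i) w = ip w w.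
  by rewrite ipBl ip_suml big1 ?subr0 // => i _; rewrite ipZl Dw // mulr0.
apply: le_lt_trans (re_ip_le _ _) _.
by rewrite expr2 ltr_pM2r.
Qed.

(** Boundedness spreads the convergence of [ip d (v n)] from a total set of [d] to
    the whole space; the limit functional is represented by Riesz' theorem. *)
Lemma bounded_weak_limit D (v : nat -> H) (C : R) : dense (linspan D) ->
  (forall n, rn (v n) <= C) ->
  (forall d, D d -> exists l : cplx R, (fun n => ip d (v n)) @ \oo --> l) ->
  exists2 w, rn w <= C & forall z, (fun n => ip z (v n)) @ \oo --> ip z w.
Proof.
move=> dD vC Dv.
have C0 : 0 <= C by apply: le_trans (rn_ge0 _) (vC 0%N).
have cvg_span d : linspan D d ->
    exists l : cplx R, (fun n => ip d (v n)) @ \oo --> l.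
  move=> [n [c [a [Da ->]]]].
  apply: (big_ind (fun x => exists l : cplx R, (fun n => ip x (v n)) @ \oo --> l)).
  - by exists 0; under eq_fun do rewrite ip0l; exact: cvg_cst.
  - move=> x y [l xl] [m ym]; exists (1 * l + m).
    by under eq_fun do rewrite ipDl -[ip x _]mul1r; exact: cvg_scalar_lin.
  - move=> i _; have [l al] := Dv _ (Da i); exists ((c i)^* * l + 0).
    under eq_fun do rewrite ipZl -[_ * _]addr0.
    by apply: cvg_scalar_lin al _; exact: cvg_cst.
have /choice[phi phiE] : forall z, exists l : cplx R, (fun n => ip (v n) z) @ \oo --> l.
  move=> z; suff [l zl] : exists l : cplx R, (fun n => ip z (v n)) @ \oo --> l.
    by exists l^*; exact: cvg_ip_conj.
  apply: cplx_cauchy_cvg => e e0.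
  (* The bound [C] may vanish, hence [C + 1]. *)
  pose q := 4 * (C + 1); have q0 : 0 < q by rewrite mulr_gt0 // ltr_wpDl.
  have [d /cvg_span[l /cvg_rnP dl] zd] := dense_rn z dD (divr_gt0 e0 q0).
  have [N Nl] := dl _ (divr_gt0 e0 (ltr0n R 4)).
  exists N => m n Nm Nn.
  have dzv k : rn (ip (z - d) (v k)) <= e / 4.
    apply: le_trans (cauchy_schwarz _ _) _.
    apply: le_trans (ler_pM (rn_ge0 _) (rn_ge0 _) (ltW zd) (vC k)) _.
    rewrite mulrAC ler_pdivrMr // /q.
    have : e * C <= e * (C + 1) by rewrite ler_pM2l // lerDl.
    by lra.
  have -> : ip z (v m) - ip z (v n) =
      (ip (z - d) (v m) - ip (z - d) (v n)) + ((ip d (v m) - l) - (ip d (v n) - l)).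
    by rewrite !ipBl; ring.
  apply: le_lt_trans (rnD _ _) _.
  have := rnB (ip (z - d) (v m)) (ip (z - d) (v n)).
  have := rnB (ip d (v m) - l) (ip d (v n) - l).
  have := dzv m; have := dzv n; have := Nl m Nm; have := Nl n Nn.
  by move=> *; lra.
have [a x y|z|w wE] := @riesz _ _ phi C.
- apply: cvg_uniq (phiE _) _; under eq_fun do rewrite ipDr ipZr.
  exact: cvg_scalar_lin.
- apply: cvg_rn_bound (phiE z) => n.
  by apply: le_trans (cauchy_schwarz _ _) _; rewrite ler_wpM2r ?rn_ge0.
have vw z : (fun n => ip z (v n)) @ \oo --> ip z w.
  rewrite -ip_conj -wE.
  have /cvg_rn := phiE z => zl.
  apply: (@cvg_rn_le _ _ _ _ (fun n => rn (ip (v n) z - phi z))) => // n.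
  by rewrite -ip_conj -rmorphB rn_conj.
exists w => //; apply: rn_le_ip => //; apply: le_trans (re_le_rn _) _.
apply: cvg_rn_bound (vw w) => n.
by apply: le_trans (cauchy_schwarz _ _) _; rewrite ler_wpM2l ?rn_ge0.
Qed.

End Density.

(** * Iterating the complement of a positive contraction *)

Section Landweber.
Variables (R : realType) (H : hilbertType R) (A : H -> H).
Hypothesis A_sym : forall v w, ip (A v) w = ip v (A w).
(** For a symmetric [A] this says that [A] is a positive contraction: it is the
    inequality [A ^+ 2 <= A]. *)
Hypothesis A_le1 : forall v, rn (A v) ^+ 2 <= re (ip v (A v)).

(** The powers of [1 - A]. They tend strongly to the projection onto the kernel
    of [A], and are polynomials in [A], which makes [1 - landweber n] a
    substitute for a functional calculus of [A]. *)
Definition landweber (n : nat) (v : H) : H := iter n (fun w => w - A w) v.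
Local Notation Q := landweber.

Lemma landweber_step v :
  rn (v - A v) ^+ 2 <= rn v ^+ 2 - re (ip v (A v)).
Proof. by rewrite rnB_sqr; have := A_le1 v; lra. Qed.

Lemma landweber_le n v : rn (Q n v) <= rn v.
Proof.
elim: n => [|n IHn] //=; apply: le_trans _ IHn.
rewrite -(@ler_pXn2r _ 2) ?nnegrE ?rn_ge0 //.
by have := landweber_step (Q n v); have := A_le1 (Q n v);
  have := sqr_ge0 (rn (A (Q n v))); lra.
Qed.

Lemma landweber_sym n v w : ip (Q n v) w = ip v (Q n w).
Proof.
elim: n v w => [|n IHn] v w //=.
by rewrite ipBl A_sym -ipBr IHn /Q -iterSr.
Qed.

Lemma landweber_lin n (a : cplx R) v w :
  Q n (a *: v + w) = a *: Q n v + Q n w.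
Proof. by apply: ip_ext => z; rewrite -landweber_sym !ipDr !ipZr -!landweber_sym. Qed.

Lemma landweberB n v w : Q n (v - w) = Q n v - Q n w.
Proof. by rewrite addrC -scaleN1r landweber_lin scaleN1r addrC. Qed.

Lemma landweber_fixed n v : A v = 0 -> Q n v = v.
Proof. by move=> Av; elim: n => //= n ->; rewrite Av subr0. Qed.

Lemma landweber_energy_le v : re (ip v (A v)) <= rn v ^+ 2.
Proof.
by have := landweber_step v; have := sqr_ge0 (rn (v - A v)); lra.
Qed.

Lemma landweber_energy_decr v :
  re (ip (v - A v) (A (v - A v))) <= re (ip v (A v)).
Proof.
have A_add x y : A (x - y) = A x - A y.
  by apply: ip_ext => z; rewrite -A_sym !ipBr -!A_sym.
rewrite A_add ipBl !ipBr !reB -(A_sym v (A v)) -rn_sqr.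
by have := landweber_energy_le (A v); have := sqr_ge0 (rn (A v)); lra.
Qed.

(** The energies [re (ip (Q n v) (A (Q n v)))] are nonincreasing in [n], and the
    squared norm of [Q n v] loses at least that energy at each step: so [n.+1]
    times the last energy is at most the initial squared norm. *)
Lemma landweber_rate n v :
  n.+1%:R * re (ip (Q n v) (A (Q n v))) <= rn v ^+ 2.
Proof.
(* The stronger bound below goes through the induction. *)
suff sum_le : rn (Q n v) ^+ 2 + n%:R * re (ip (Q n v) (A (Q n v))) <= rn v ^+ 2.
  apply: le_trans _ sum_le; rewrite -natr1 mulrDl mul1r addrC lerD2r.
  exact: landweber_energy_le.
elim: n => [|n IHn]; first by rewrite mul0r addr0.
apply: le_trans _ IHn; rewrite /=.
have step := landweber_step (Q n v).
have : n.+1%:R * re (ip (Q n.+1 v) (A (Q n.+1 v))) <=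
       n.+1%:R * re (ip (Q n v) (A (Q n v))).
  by rewrite ler_wpM2l // landweber_energy_decr.
move: step; rewrite -natr1 /=.
set a := rn (Q n v - _) ^+ 2; set b := re (ip (_ - _) _).
by set c := re _; set d := rn _ ^+ 2; set x := n%:R => ? ?; lra.
Qed.

End Landweber.
(** * Norms and adjoints in the interior tensor product *)

Section InteriorTensor.
Variables (R : realType) (H : hilbertType R) (B : set (H -> H)).
Hypothesis B_bounded : B `<=` @bounded_op R H H.
Variables (X : cstar_module B) (T : interior_tensor X).
Implicit Types (x y : X) (h k : H) (z w : T).

Local Notation "x ⊗ h" := (it_tens T x h) (at level 35).

Lemma tens_lin a x y h : (a *: x + y) ⊗ h = a *: (x ⊗ h) + y ⊗ h.
Proof. exact: (it_linearl T h). Qed.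

Lemma tens0l h : 0 ⊗ h = 0.
Proof. exact: lin0 (it_linearl T h). Qed.

Lemma tens0r x : x ⊗ 0 = 0.
Proof. exact: lin0 (it_linearr T x). Qed.

Lemma tensZl a x h : (a *: x) ⊗ h = a *: (x ⊗ h).
Proof. exact: linZ a x (it_linearl T h). Qed.

Lemma tensDl x y h : (x + y) ⊗ h = x ⊗ h + y ⊗ h.
Proof. by rewrite -[x]scale1r tens_lin !scale1r. Qed.

Lemma tensBl x y h : (x - y) ⊗ h = x ⊗ h - y ⊗ h.
Proof. by rewrite tensDl -scaleN1r tensZl scaleN1r. Qed.

Lemma tens_suml n (F : 'I_n -> X) h : (\sum_i F i) ⊗ h = \sum_i F i ⊗ h.
Proof.
by apply: (big_morph (fun x => x ⊗ h)) => [x y|]; [exact: tensDl|exact: tens0l].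
Qed.

Lemma ip_inner x y h k : ip h (cm_inner x y k) = ip (x ⊗ h) (y ⊗ k).
Proof. by rewrite it_ip. Qed.

Lemma op_ext (S S' : H -> H) : (forall h k, ip h (S k) = ip h (S' k)) -> S = S'.
Proof. by move=> SS'; apply/funext => k; apply: ip_ext => h. Qed.

Lemma rn_sqr_opnorm x : rn x ^+ 2 = opnorm (cm_inner x x).
Proof.
have := cm_normE x; rewrite rnE !expr2 -rcM.
exact: (@rc_inj R).
Qed.

Lemma rn_tens_le x h : rn (x ⊗ h) <= rn x * rn h.
Proof.
rewrite -(@ler_pXn2r _ 2) ?nnegrE ?mulr_ge0 ?rn_ge0 // exprMn rn_sqr_opnorm.
rewrite rn_sqr it_ip; apply: le_trans (re_ip_le _ _) _.
rewrite mulrC (expr2 (rn h)) mulrA ler_wpM2r ?rn_ge0 //.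
by apply/ler_opnorm/B_bounded; exact: cm_inner_in.
Qed.

Lemma rn_inner_tens x y h : rn (cm_inner x y h) <= rn x * rn (y ⊗ h).
Proof.
apply: rn_le_ip; first by rewrite mulr_ge0 ?rn_ge0.
rewrite ip_inner; apply: le_trans (re_ip_le _ _) _.
by rewrite mulrA [rn (cm_inner x y h) * _]mulrC ler_wpM2r ?rn_ge0 // rn_tens_le.
Qed.

(** The embedding of the module in the bounded operators is isometric: this is
    the way back from norm estimates in the tensor product to the module. *)
Lemma rn_le_tens x (C : R) : 0 <= C -> (forall h, rn (x ⊗ h) <= C * rn h) ->
  rn x <= C.
Proof.
move=> C0 xC; rewrite -(@ler_pXn2r _ 2) ?nnegrE ?rn_ge0 // rn_sqr_opnorm expr2.
apply: opnorm_le => [|h]; first exact: mulr_ge0.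
apply: rn_le_ip; first by rewrite !mulr_ge0 ?rn_ge0.
rewrite ip_inner; apply: le_trans (re_ip_le _ _) _; set g := cm_inner x x h.
have -> : rn g * (C * C * rn h) = (C * rn g) * (C * rn h) by ring.
by apply: ler_pM; rewrite ?rn_ge0.
Qed.

Lemma bounded_tens x : bounded_op (it_tens T x).
Proof.
apply/bounded_opP; split; first exact: it_linearr.
by exists (rn x) => [|h]; [exact: rn_ge0|exact: rn_tens_le].
Qed.

Lemma exists_tens_adj : exists S : X -> T -> H,
  forall x h z, ip (x ⊗ h) z = ip h (S x z).
Proof.
have adj x : exists S : T -> H, forall h z, ip (x ⊗ h) z = ip h (S z).
  by have [S _ xS] := exists_adjoint (bounded_tens x); exists S.
by have [S SE] := choice adj; exists S.
Qed.

Definition tens_adj : X -> T -> H := sval (cid exists_tens_adj).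

Lemma tens_adjE x h z : ip (x ⊗ h) z = ip h (tens_adj x z).
Proof. exact: (svalP (cid exists_tens_adj)). Qed.

Lemma tens_adj_tens x y h : tens_adj x (y ⊗ h) = cm_inner x y h.
Proof. by apply: ip_ext => k; rewrite -tens_adjE it_ip. Qed.

Lemma rn_tens_adj x z : rn (tens_adj x z) <= rn x * rn z.
Proof.
apply: rn_le_ip; first by rewrite mulr_ge0 ?rn_ge0.
rewrite -tens_adjE; apply: le_trans (re_ip_le _ _) _.
by rewrite mulrA [rn (tens_adj x z) * _]mulrC ler_wpM2r ?rn_ge0 // rn_tens_le.
Qed.

(** * Frame operators of finite families *)

Section Frame.
Variables (N : nat) (x : nat -> X).

(** The operator [\sum_i |x i><x i|] on the module; [frameT] is its ampliation to
    the tensor product. *)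
Definition frame (y : X) : X := \sum_(i < N) cm_act (x i) (cm_inner (x i) y).

Definition frameT z : T := \sum_(i < N) x i ⊗ tens_adj (x i) z.

Lemma frameT_tens y h : frameT (y ⊗ h) = frame y ⊗ h.
Proof.
rewrite tens_suml; apply: eq_bigr => i _.
by rewrite tens_adj_tens it_balanced //; exact: cm_inner_in.
Qed.

Lemma ip_frameT z w : ip z (frameT w) =
  \sum_(i < N) ip (tens_adj (x i) z) (tens_adj (x i) w).
Proof.
rewrite ip_sumr; apply: eq_bigr => i _.
by rewrite -ip_conj tens_adjE ip_conj.
Qed.

Lemma frameT_sym z w : ip (frameT z) w = ip z (frameT w).
Proof.
rewrite ip_frameT -ip_conj ip_frameT rmorph_sum /=.
by apply: eq_bigr => i _; rewrite ip_conj.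
Qed.

Lemma frameT_energy z : re (ip z (frameT z)) = \sum_(i < N) rn (tens_adj (x i) z) ^+ 2.
Proof. by rewrite ip_frameT re_sum; apply: eq_bigr => i _; rewrite rn_sqr. Qed.

Hypothesis frame_le1 : \sum_(i < N) rn (x i) ^+ 2 <= 1.

Lemma frameT_le1 z : rn (frameT z) ^+ 2 <= re (ip z (frameT z)).
Proof.
rewrite frameT_energy; set A := frameT z; set e := \sum_(i < N) _.
(* Expanding one factor [A] of [ip A A] and using [a * b <= (a ^+ 2 + b ^+ 2) / 2]
   on each term bounds [rn A ^+ 2] by its average with the energy. *)
suff : rn A ^+ 2 <= (rn A ^+ 2 + e) / 2 by lra.
rewrite {1}rn_sqr {2}/A ip_frameT re_sum.
apply: (@le_trans _ _
  (\sum_(i < N) (rn (x i) ^+ 2 * rn A ^+ 2 + rn (tens_adj (x i) z) ^+ 2) / 2)).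
  apply: ler_sum => i _.
  apply: le_trans (re_ip_le _ _) _.
  have a_le := rn_tens_adj (x i) A.
  have : rn (tens_adj (x i) A) ^+ 2 <= rn (x i) ^+ 2 * rn A ^+ 2.
    by rewrite -exprMn ler_pXn2r ?nnegrE ?mulr_ge0 ?rn_ge0.
  have := sqr_ge0 (rn (tens_adj (x i) A) - rn (tens_adj (x i) z)).
  set a := rn (tens_adj (x i) A); set b := rn (tens_adj (x i) z).
  by rewrite sqrrB; set c := a ^+ 2; set d := b ^+ 2; lra.
rewrite -mulr_suml big_split /= -mulr_suml -/e.
rewrite ler_pM2r ?invr_gt0 // lerD2r -[leRHS]mul1r.
by rewrite ler_wpM2r // sqr_ge0.
Qed.

Definition residual (n : nat) (y : X) : X := iter n (fun w : X => w - frame w) y.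

Lemma residual_tens n y h : residual n y ⊗ h = landweber frameT n (y ⊗ h).
Proof. by elim: n => //= n IHn; rewrite tensBl -frameT_tens IHn. Qed.

Lemma rn_residual_tens n y h : rn (residual n y ⊗ h) <= rn (y ⊗ h).
Proof. by rewrite residual_tens; apply: landweber_le; exact: frameT_le1. Qed.

Lemma rn_residual n y : rn (residual n y) <= rn y.
Proof.
apply: rn_le_tens => [|h]; first exact: rn_ge0.
by apply: le_trans (rn_residual_tens _ _ _) (rn_tens_le _ _).
Qed.

(** The residual is a selfadjoint module map, since its ampliation is. *)
Lemma inner_residual n u y : cm_inner u (residual n y) = cm_inner (residual n u) y.
Proof.
apply: op_ext => h k; rewrite !ip_inner !residual_tens.
by rewrite landweber_sym //; exact: frameT_sym.
Qed.

Lemma rn_generator_le1 i : (i < N)%N -> rn (x i) <= 1.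
Proof.
move=> iN; rewrite -(@ler_pXn2r _ 2) ?nnegrE ?rn_ge0 // expr1n.
apply: le_trans frame_le1; rewrite (bigD1 (Ordinal iN)) //= lerDl.
by apply: sumr_ge0 => j _; apply: sqr_ge0.
Qed.

(** The energy of the residual [z] after [n] more steps bounds the adjoint of
    [x i] at that vector, and by symmetry [rn z ^+ 2] is the inner product of
    [x i ⊗ h] with that same vector. The decay is uniform in [h], hence it
    is a decay in the norm of the module. *)
Lemma generator_decay i n h : (i < N)%N ->
  n.+1%:R * rn (landweber frameT n (x i ⊗ h)) ^+ 4 <= rn h ^+ 4.
Proof.
move=> iN; set z := landweber _ _ _.
set a := tens_adj (x i) (landweber frameT n z).
have z_le : rn z <= rn h.
  apply: le_trans (landweber_le frameT_le1 _ _) (le_trans (rn_tens_le _ _) _).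
  by rewrite ler_piMl ?rn_ge0 // rn_generator_le1.
have a_le : n.+1%:R * rn a ^+ 2 <= rn h ^+ 2.
  apply: (@le_trans _ _ (rn z ^+ 2)); last by rewrite ler_pXn2r ?nnegrE ?rn_ge0.
  apply: le_trans _ (landweber_rate frameT_sym frameT_le1 n z).
  rewrite ler_wpM2l // frameT_energy (bigD1 (Ordinal iN)) //= lerDl.
  by apply: sumr_ge0 => j _; apply: sqr_ge0.
have z2_le : rn z ^+ 2 <= rn h * rn a.
  rewrite rn_sqr {1}/z landweber_sym; last exact: frameT_sym.
  by rewrite tens_adjE; exact: re_ip_le.
apply: (@le_trans _ _ (n.+1%:R * (rn h * rn a) ^+ 2)).
  rewrite ler_pM2l // (exprM _ 2 2) ler_pXn2r ?nnegrE ?sqr_ge0 //.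
  by rewrite mulr_ge0 ?rn_ge0.
rewrite exprMn mulrCA (exprM (rn h) 2 2) [leRHS]expr2.
by rewrite ler_wpM2l ?sqr_ge0.
Qed.

End Frame.
End InteriorTensor.
(** * Bounded module maps *)

Lemma le_of_pow4_decay (R : realType) (e : R) : 0 < e ->
  exists N, forall n, (N <= n)%N -> forall r q : R, 0 <= r -> 0 <= q ->
  n.+1%:R * r ^+ 4 <= q ^+ 4 -> r <= e * q.
Proof.
move=> e0; exists (Num.truncn (e ^- 4)) => n Nn r q r0 q0 rq.
rewrite -(@ler_pXn2r _ 4) ?nnegrE ?mulr_ge0 ?(ltW e0) // exprMn.
have e4 : 0 < e ^+ 4 by rewrite exprn_gt0.
apply: le_trans _ (ler_wpM2l (ltW e4) rq).
rewrite mulrA ler_peMl ?exprn_ge0 // mulrC -ler_pdivrMr // mul1r ltW //.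
by apply: lt_le_trans (truncnS_gt _) _; rewrite ler_nat.
Qed.

Section ModuleMap.
Variables (R : realType) (H : hilbertType R) (B : set (H -> H)).
Hypothesis B_cstar : cstar_subalgebra B.
Variables (X : cstar_module B) (T : interior_tensor X).
Implicit Types (y : X) (h k : H).

Let B_bounded : B `<=` @bounded_op R H H := cstar_bounded B_cstar.
Local Notation "x ⊗ h" := (it_tens T x h) (at level 35).

Variable f : X -> H -> H.
Hypothesis f_in : forall y, B (f y).
Hypothesis f_lin : linear f.
Hypothesis f_act : forall y b, B b -> f (cm_act y b) = f y \o b.
Variable M : R.
Hypothesis M_ge0 : 0 <= M.
Hypothesis f_bounded : forall y, opnorm (f y) <= M * rn y.

Lemma module_map0 : f 0 = 0.
Proof. exact: lin0. Qed.

Lemma module_mapD y y' : f (y + y') = f y + f y'.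
Proof. by rewrite -[y]scale1r f_lin !scale1r. Qed.

Lemma module_mapZ a y : f (a *: y) = a *: f y.
Proof. exact: linZ. Qed.

Lemma ip_module_map_sum n (F : 'I_n -> X) h k :
  ip h (f (\sum_i F i) k) = \sum_i ip h (f (F i) k).
Proof.
apply: (big_morph (fun y => ip h (f y k))) => [y y'|].
  by rewrite module_mapD -ipDr.
by rewrite module_map0; exact: ip0r.
Qed.

Lemma module_map_le y h : rn (f y h) <= M * rn y * rn h.
Proof.
apply: le_trans (ler_opnorm h (B_bounded (f_in y))) _.
by rewrite ler_wpM2r ?rn_ge0.
Qed.

Section FiniteRank.
Variables (N : nat) (x : nat -> X).

(** [f] applied to [x i] times [cm_inner (x i) y] is the operator [f (x i)]
    composed with [cm_inner (x i) y]; the adjoint of [f (x i)] lies in [B] and can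
    act on [x i]. So [f] is represented by an element on finite rank operators. *)
Lemma module_map_frame : exists u : X, forall y, f (frame N x y) = cm_inner u y.
Proof.
have /choice[g gE] : forall i, exists g, B g /\ is_adjoint (f (x i)) g.
  by move=> i; have [g Bg adj] := cstar_adj B_cstar (f_in (x i)); exists g.
exists (\sum_(i < N) cm_act (x i) (g i)) => y; apply: op_ext => h k.
rewrite ip_module_map_sum (ip_inner T) tens_suml ip_suml.
apply: eq_bigr => i _; have [Bg adj] := gE i.
rewrite f_act; last exact: cm_inner_in.
by rewrite it_balanced // it_ip /= -ip_conj adj ip_conj.
Qed.

(** [1 - residual n] is [frame] applied to a sum of residuals, which are
    selfadjoint and can be moved to the representing element. *)
Lemma module_map_finite_rank n :
  exists u : X, forall y, f (y - residual N x n y) = cm_inner u y.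
Proof.
have [v vE] := module_map_frame.
elim: n => [|n [u uE]].
  exists 0 => y; rewrite subrr module_map0; apply: op_ext => h k.
  by rewrite (ip_inner T) tens0l ip0l; exact: ip0r.
exists (u + residual N x n v) => y; apply: op_ext => h k.
have -> : y - residual N x n.+1 y =
    (y - residual N x n y) + frame N x (residual N x n y).
  by rewrite /= opprB addrA addrAC.
rewrite module_mapD uE vE (inner_residual B_bounded T).
by rewrite [RHS](ip_inner T) tensDl ipDl -!ip_inner -ipDr.
Qed.

Hypothesis frame_le1 : \sum_(i < N) rn (x i) ^+ 2 <= 1.

(** The squared norm of [u] is the norm of [cm_inner u u], that is of [f] at
    [u - residual n u], whose norm is at most [2 * rn u]. *)
Lemma module_map_compress n : exists2 u : X, rn u <= 2 * M &
  forall y, f (y - residual N x n y) = cm_inner u y.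
Proof.
have [u uE] := module_map_finite_rank n; exists u => //.
have [u0|u0] := eqVneq (rn u) 0; first by rewrite u0 mulr_ge0.
have u_gt0 : 0 < rn u by rewrite lt_def u0 rn_ge0.
rewrite -(ler_pM2r u_gt0) -expr2 rn_sqr_opnorm -uE.
apply: le_trans (f_bounded _) _; rewrite mulrAC mulrC ler_wpM2r //.
apply: le_trans (rnB _ _) _.
have := rn_residual B_bounded T frame_le1 n u; lra.
Qed.

End FiniteRank.

(** Paschke's inequality up to the factor [2]. For the family reduced to [y], up to
    a small residual [f y] is [cm_inner u y], and that is the adjoint of [u] at
    [y ⊗ h], with [rn u <= 2 * M]. *)
Lemma module_map_tens_le y h : rn (f y h) <= 2 * M * rn (y ⊗ h).
Proof.
wlog y_le1 : y / rn y <= 1.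
  move=> small; pose t := (1 + rn y)^-1.
  have t_gt0 : 0 < t by rewrite invr_gt0 ltr_pwDl ?rn_ge0.
  have ty_le1 : rn (rc t *: y) <= 1.
    rewrite rnZ rn_rc gtr0_norm // mulrC ler_pdivrMr ?mul1r ?lerDr //.
    by rewrite ltr_pwDl ?rn_ge0.
  have := small _ ty_le1.
  by rewrite module_mapZ tensZl !rnZ rn_rc gtr0_norm // mulrCA ler_pM2l.
(* The residual enters through [M * rn r * rn h], to be made smaller than [e]. *)
have frame_le1 : \sum_(i < 1) rn (y : X) ^+ 2 <= 1.
  by rewrite big_ord1 expr_le1 ?rn_ge0.
apply/ler_addgt0Pl => e e0.
pose q := M * rn h + 1; have q0 : 0 < q by rewrite ltr_wpDl // mulr_ge0 ?rn_ge0.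
have [n /(_ n (leqnn n)) decay] := le_of_pow4_decay (divr_gt0 e0 q0).
have [u u_le uE] := module_map_compress frame_le1 n.
pose r := residual 1 (fun=> y) n y.
have r_le : rn r <= e / q.
  apply: (@rn_le_tens _ _ _ _ T) => [|k]; first by rewrite ltW ?divr_gt0.
  apply: decay; rewrite ?rn_ge0 // (residual_tens B_bounded).
  exact: (@generator_decay _ _ _ B_bounded _ _ _ (fun=> y) frame_le1 0).
have -> : f y h = f r h + cm_inner u y h.
  by rewrite -uE -[f r h + _]/((f r + f (y - r)) h) -module_mapD addrC subrK.
apply: le_trans (rnD _ _) (lerD _ _).
  apply: le_trans (module_map_le _ _) _.
  rewrite mulrAC; apply: le_trans (ler_wpM2l _ r_le) _.
    by rewrite mulr_ge0 ?rn_ge0.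
  by rewrite mulrCA ler_piMr ?(ltW e0) // ler_pdivrMr // mul1r lerDl.
apply: le_trans (rn_inner_tens B_bounded T _ _ _) _.
by rewrite ler_wpM2r ?rn_ge0.
Qed.

End ModuleMap.
(** * Selfdual modules are closed *)

Section SelfdualSigma.
Variables (R : realType) (H : hilbertType R) (B : set (H -> H)).
Hypothesis B_sigma : sigma_star_algebra B.
Variables (X : cstar_module B) (T : interior_tensor X).
Implicit Types (y : X) (h k : H) (z w : T).

Let B_cstar : cstar_subalgebra B := sigma_star_cstar B_sigma.
Let B_bounded : B `<=` @bounded_op R H H := cstar_bounded B_cstar.
Local Notation "x ⊗ h" := (it_tens T x h) (at level 35).

(** The adjoint of a limit operator [S] turns [y] into [S' \o (y ⊗ _)], a WOT limit
    of operators [cm_inner (v n) y], hence an element of [B]: it is a bounded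
    module map, and the element representing it is [S]. *)
Lemma selfdual_sigma_star_module : selfdual X -> sigma_star_module T.
Proof.
move=> sd u S uX S_bounded uS.
have [S' S'_bounded adj] := exists_adjoint S_bounded.
have [S'lin [C C0 S'C]] := (bounded_opP S').1 S'_bounded.
pose f y := S' \o it_tens T y.
have f_bound y h : rn (f y h) <= C * rn y * rn h.
  apply: le_trans (S'C _) _.
  by rewrite -mulrA ler_wpM2l // rn_tens_le.
have fB y : B (f y).
  have /choice[v vE] : forall n, exists v : X, it_tens T v = u n.
    by move=> n; have [v _ uE] := uX n; exists v.
  apply: (sigma_star_wot_closed B_sigma (u := fun n => cm_inner (v n) y)).
  - by move=> n; exact: cm_inner_in.
  - apply/bounded_opP; split=> [a h k|]; last first.
      by exists (C * rn y) => //; rewrite mulr_ge0 ?rn_ge0.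
    by rewrite /f /= it_linearr S'lin.
  - move=> h k; rewrite /f /= -adj.
    under eq_fun do rewrite -(it_ip T) vE.
    by rewrite -ip_conj; apply: cvg_ip_conj; exact: uS.
have f_lin : linear f.
  by move=> a y y'; apply/funext => h; rewrite /f /= tens_lin S'lin.
have [x xE] : exists x : X, forall y, f y = cm_inner x y.
  apply: sd; split=> //.
    by move=> y b Bb; apply/funext => h; rewrite /f /= it_balanced.
  exists C => y; apply: opnorm_le => [|h]; last exact: f_bound.
  by rewrite mulr_ge0 ?rn_ge0.
exists x => //; apply/funext => h; apply/eqP; rewrite -subr_eq0; apply/eqP.
apply: (total_orthogonal_eq0 (@it_dense _ _ _ _ T)) => _ [y [k ->]].
rewrite ipBr -[ip _ (S h)]ip_conj adj.
have -> : S' (y ⊗ k) = cm_inner x y k by rewrite -xE.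
by rewrite -(it_ip T) ip_conj subrr.
Qed.

(** * Modules generated by a sequence in a closed module *)

Hypothesis T_sigma : sigma_star_module T.

(** A bounded sequence that converges weakly on elementary tensors has a bounded
    limit operator, and closedness says that the limit comes from the module. *)
Lemma sigma_star_module_complete (u : nat -> X) (C : R) :
  (forall n, rn (u n) <= C) ->
  (forall y h k, exists l : cplx R, (fun n => ip (y ⊗ k) (u n ⊗ h)) @ \oo --> l) ->
  exists x : X, forall z h, (fun n => ip z (u n ⊗ h)) @ \oo --> ip z (x ⊗ h).
Proof.
move=> uC u_cvg.
have C0 : 0 <= C by apply: le_trans (rn_ge0 _) (uC 0%N).
have /choice[Z ZE] : forall h, exists w, rn w <= C * rn h /\
    forall z, (fun n => ip z (u n ⊗ h)) @ \oo --> ip z w.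
  move=> h; have [n|_ [y [k ->]]|w w_le wE] :=
      @bounded_weak_limit _ _ _ (fun n => u n ⊗ h) (C * rn h) (@it_dense _ _ _ _ T).
  - by apply: le_trans (rn_tens_le B_bounded _ _ _) _; rewrite ler_wpM2r ?rn_ge0.
  - exact: u_cvg.
  - by exists w.
have [x _ xE] : range (it_tens T) Z.
  apply: (T_sigma (u := fun n => it_tens T (u n))).
  - by move=> n; exists (u n).
  - apply/bounded_opP; split; last by exists C => // h; exact: (ZE h).1.
    move=> a h k; apply: ip_ext => z; apply: cvg_uniq ((ZE _).2 z) _.
    under eq_fun do rewrite it_linearr ipDr ipZr.
    by rewrite ipDr ipZr; apply: cvg_scalar_lin; exact: (ZE _).2.
  - by move=> h z; exact: (ZE h).2.
by exists x => z h; rewrite xE; exact: (ZE h).2.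
Qed.

Section Residual.
Variable x : nat -> X.
Hypothesis x_le1 : forall N, \sum_(i < N) rn (x i) ^+ 2 <= 1.
(** What generation of the module by [x] in the topology WOT over [B] is used
    for: only [0] is orthogonal to all the [x i]. *)
Hypothesis x_gen : forall u : X, (forall i h k, ip (x i ⊗ k) (u ⊗ h) = 0) -> u = 0.

(** Both the family and the number of iterations grow with [N]. *)
Local Notation W N := (landweber (frameT B_bounded N x) N).

Lemma residual_generator i h : (fun N => W N (x i ⊗ h)) @ \oo --> (0 : T).
Proof.
apply/cvg_rnP => e e0.
pose q := rn h + 1; have q0 : 0 < q by rewrite ltr_wpDl ?rn_ge0.
have [n decay] := le_of_pow4_decay (divr_gt0 e0 q0).
exists (maxn n i.+1) => N; rewrite geq_max subr0 => /andP[/decay nN iN].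
apply: le_lt_trans (nN _ (rn h) (rn_ge0 _) (rn_ge0 _) _) _.
  exact: generator_decay.
by rewrite mulrAC ltr_pdivrMr // ltr_pM2l // ltrDl.
Qed.

(** The vectors on which [W] tends to [0] form a closed subspace [V] containing the
    [x i ⊗ k], and [W] fixes its orthogonal complement. So [W (y ⊗ k)] tends to
    the component [w k] of [y ⊗ k] orthogonal to [V]. By completeness of the
    module [w k] is [u ⊗ k] for some [u], which is orthogonal to the [x i], so
    [u = 0]. *)
Lemma residual_cvg0 y h : (fun N => residual N x N y ⊗ h) @ \oo --> (0 : T).
Proof.
pose V := [set z : T | (fun N => W N z) @ \oo --> (0 : T)].
have W_lin N := landweber_lin (@frameT_sym _ _ _ B_bounded _ T N x) N.
have W_sub N := landweberB (@frameT_sym _ _ _ B_bounded _ T N x) N.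
have V_sub : linear_subspace V.
  split=> [|a z w zV wV].
    rewrite /V /=; under eq_fun => N.
      rewrite (lin0 (W_lin N)).
      over.
    exact: cvg_cst.
  rewrite /V /=; under eq_fun do rewrite W_lin.
  by rewrite -[0](addr0 (0 : T)) -{1}(scaler0 _ a); exact: cvg_lin.
have V_closed : seq_closed V.
  move=> u l uV /cvg_rnP ul; apply/cvg_rnP => e e0.
  have e2 : 0 < e / 2 by rewrite divr_gt0.
  have [m /(_ m (leqnn m)) um] := ul _ e2.
  have /cvg_rnP/(_ _ e2)[N0 Nu] := uV m.
  exists N0 => N /Nu; rewrite !subr0 => Wu.
  have -> : W N l = W N (u m) - W N (u m - l) by rewrite W_sub subKr.
  apply: le_lt_trans (rnB _ _) _.
  have := landweber_le (frameT_le1 B_bounded (x_le1 N)) N (u m - l); lra.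
have V_gen i k : V (x i ⊗ k) := residual_generator i k.
have /choice[w wE] : forall k, exists w : T, (forall v, V v -> ip v w = 0) /\
    V (y ⊗ k - w).
  move=> k; have [v [w [yvw Vv w_perp]]] := orthogonal_decomposition (y ⊗ k) V_sub V_closed.
  by exists w; split=> //; rewrite yvw addrK.
have w_fixed N n k : landweber (frameT B_bounded N x) n (w k) = w k.
  have Aw : frameT B_bounded N x (w k) = 0.
    apply: big1 => i _; suff -> : tens_adj B_bounded (x i) (w k) = 0.
      exact: tens0r.
    by apply: ip_ext => v; rewrite -tens_adjE ip0r; exact: (wE k).1.
  exact: landweber_fixed.
have y_cvg k : (fun N => residual N x N y ⊗ k) @ \oo --> w k.
  have /cvg_rn yk := (wE k).2; apply/cvg_rn.
  suff -> : (fun N => rn (residual N x N y ⊗ k - w k)) =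
            (fun N => rn (W N (y ⊗ k - w k) - 0)) by [].
  by apply/funext => N; rewrite (residual_tens B_bounded) subr0 W_sub w_fixed.
have [|y' h' k'|u uE] := @sigma_star_module_complete (fun N => residual N x N y) (rn y).
- by move=> N; apply: (rn_residual B_bounded T).
- by exists (ip (y' ⊗ k') (w h')); exact: cvg_ipr (y_cvg h').
have uw k : u ⊗ k = w k.
  by apply: ip_ext => z; apply: cvg_uniq (uE z k) (cvg_ipr (y_cvg k)).
have u0 : u = 0.
  apply: x_gen => i k k'; rewrite uw; exact: (wE k).1.
by have := y_cvg h; rewrite -uw u0 tens0l.
Qed.

(** The elements [u N] representing [f] on [1 - residual N] are bounded, and
    by Paschke's inequality [cm_inner (u N) y] tends to [f y] because the
    residuals of [y] tend to [0]; so their weak limit represents [f]. *)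
Lemma module_map_represented (f : X -> H -> H) (M : R) :
  (forall y, B (f y)) -> linear f ->
  (forall y b, B b -> f (cm_act y b) = f y \o b) ->
  0 <= M -> (forall y, opnorm (f y) <= M * rn y) ->
  exists z : X, forall y, f y = cm_inner z y.
Proof.
move=> fB f_lin f_act M0 f_bnd.
have /choice[u uE] : forall N, exists u : X, rn u <= 2 * M /\
    forall y, f (y - residual N x N y) = cm_inner u y.
  move=> N.
  have [u u_le uE] := module_map_compress B_cstar T fB f_lin f_act M0 f_bnd (x_le1 N) N.
  by exists u.
have u_cvg y k h : (fun N => ip (y ⊗ k) (u N ⊗ h)) @ \oo --> ip (f y k) h.
  rewrite -ip_conj; under eq_fun do rewrite -ip_conj.
  under eq_fun do rewrite it_ip ip_conj.
  rewrite ip_conj -[ip (f y k) h]ip_conj; apply: cvg_ip_conj; apply: cvg_ipr.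
  have /cvg_rn r0 := residual_cvg0 y k.
  apply: (@cvg_rn_le _ _ _ _ (fun N => 2 * M * rn (residual N x N y ⊗ k - 0))) => [N|].
    rewrite -(uE N).2 -rnN opprB subr0.
    have -> : f y k - f (y - residual N x N y) k = f (residual N x N y) k.
      apply/eqP; rewrite subr_eq; apply/eqP.
      rewrite -[RHS]/((f _ + f _) k) -(module_mapD f_lin).
      by rewrite addrC subrK.
    exact: (module_map_tens_le B_cstar T fB f_lin f_act M0 f_bnd).
  by rewrite -(mulr0 (2 * M)); apply: cvgMl_tmp.
have [N|y k h|z zE] := @sigma_star_module_complete u (2 * M).
- exact: (uE N).1.
- by exists (ip (f y h) k); exact: u_cvg.
exists z => y; apply: op_ext => h k.
rewrite -(it_ip T) -[LHS]ip_conj -[RHS]ip_conj; congr (_^*).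
by apply: cvg_uniq (u_cvg y k h) (zE _ _).
Qed.

End Residual.
End SelfdualSigma.
(** * The equivalence *)

(** The factors [2^-1 ^+ i.+1 / (1 + rn (x i))] make the squared norms at most
    [2^-1 ^+ i.+1]. *)
Lemma scaled_generators (R : realType) (V : normedModType (cplx R)) (x : nat -> V) :
  exists2 t : nat -> R, forall i, 0 < t i &
    forall N, \sum_(i < N) rn (rc (t i) *: x i) ^+ 2 <= 1.
Proof.
pose t i : R := 2^-1 ^+ i.+1 / (1 + rn (x i)).
have x_gt0 i : 0 < 1 + rn (x i) by rewrite ltr_pwDl ?rn_ge0.
have t_gt0 i : 0 < t i by rewrite divr_gt0 ?exprn_gt0 ?invr_gt0.
exists t => // N.
have tx_le i : rn (rc (t i) *: x i) ^+ 2 <= 2^-1 ^+ i.+1.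
  have pow_le1 : 2^-1 ^+ i.+1 <= 1 :> R.
    by rewrite exprn_ile1 ?invr_ge0 // invf_le1 // ler1n.
  have le_pow : rn (rc (t i) *: x i) <= 2^-1 ^+ i.+1.
    rewrite rnZ rn_rc gtr0_norm // mulrAC ler_pdivrMr //.
    by rewrite ler_pM2l ?exprn_gt0 ?invr_gt0 // lerDr.
  rewrite expr2; apply: le_trans (ler_pM _ _ le_pow le_pow) _; rewrite ?rn_ge0 //.
  by rewrite ler_piMr // exprn_ge0 ?invr_ge0.
apply: (@le_trans _ _ (\sum_(i < N) 2^-1 ^+ i.+1)); first exact: ler_sum.
suff -> : \sum_(i < N) 2^-1 ^+ i.+1 = 1 - 2^-1 ^+ N :> R.
  by rewrite gerBl exprn_ge0 ?invr_ge0.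
elim: N => [|N IHN]; first by rewrite big_ord0 expr0 subrr.
by rewrite big_ord_recr /= IHN exprS; field.
Qed.

Theorem theorem4p10 (R : realType) (H : hilbertType R) (B : set (H -> H))
    (B_sigma : sigma_star_algebra B)
    (X : cstar_module B)
    (X_gen : sigma_star_countably_generated X)
    (T : interior_tensor X) :
  sigma_star_module T <-> selfdual X.
Proof.
split; last exact: selfdual_sigma_star_module.
move=> T_sigma f [fB f_lin f_act [M f_bnd]].
have [x x_gen] := X_gen.
have [t t_gt0 tx_le1] := scaled_generators x.
apply: (@module_map_represented _ _ _ B_sigma _ _ T_sigma (fun i => rc (t i) *: x i)
  tx_le1 _ f `|M| fB f_lin f_act (normr_ge0 M)).
- move=> u xu.
  have xu0 i h k : ip (it_tens T (x i) k) (it_tens T u h) = 0.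
    have := xu i h k; rewrite /= tensZl ipZl rc_conj => /eqP.
    by rewrite mulf_eq0 rc_eq0 gt_eqF //= => /eqP.
  have /(congr1 (fun S : set X => S u)) : [set y : X | cm_inner y u = 0] = setT.
    apply: x_gen => [N b Bb|v y v0 vy] /=; apply: op_ext => h k; rewrite [RHS]ip0r.
      rewrite (ip_inner T) tens_suml ip_suml big1 // => i _.
      by rewrite it_balanced.
    apply: cvg_uniq (vy u k h) _.
    under eq_fun do rewrite v0.
    by rewrite ip0r; exact: cvg_cst.
  by move=> /= uu; apply: cm_inner_eq0; rewrite uu.
- move=> y; apply: le_trans (f_bnd y) _.
  by rewrite ler_wpM2r ?rn_ge0 // ler_norm.
Qed.
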